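(* Let $(J,W)$ be a thin graphon in which the bigraph $F=(U_1,U_2,E)$ is excluded as an induced sub-bigraph, i.e. $t^{\sf b}_{\rm ind}(F,W)=0$, and let $|V|=|U_1|+|U_2|$ denote its number of nodes. Then for every $0<\varepsilon<1$, $(J,W)$ has an ultra-strong regularity partition with error $\varepsilon$ and with $O(\varepsilon^{-10|V|^2})$ classes (the implied constant not depending on $\varepsilon$).
   Context: A graphon is a pair $(J,W)$ with $J$ a standard probability space (measure $\pi$) and $W:J\times J\to[0,1]$ symmetric measurable. A bigraph is $F=(U_1,U_2,E)$ with finite $U_1,U_2$ and $E\subseteq U_1\times U_2$; $t^{\sf b}_{\rm ind}(F,W)=\int_{J^{U_1}}\int_{J^{U_2}}\prod_{(i,j)\in E}W(x_i,y_j)\prod_{(i,j)\in(U_1\times U_2)\setminus E}(1-W(x_i,y_j))\,dy\,dx$. A graphon is thin if $t^{\sf b}_{\rm ind}(F,W)=0$ for some bigraph $F$. For a partition $\mathcal{P}$ of $J$ into measurable sets of positive measure, with $S(x)$ the class of $x$, $W_{\mathcal{P}}(x,y)=\frac{1}{\pi(S(x))\pi(S(y))}\int_{S(x)\times S(y)}W$; $\mathcal{P}$ is an ultra-strong regularity partition with error $\varepsilon$ if $\int_{J\times J}|W-W_{\mathcal{P}}|\le\varepsilon$. *)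

(* Defs.v *)
From HB Require Import structures.
From mathcomp Require Export all_boot all_order all_algebra.
From mathcomp Require Export all_classical all_reals all_analysis.
Export Order.TTheory GRing.Theory Num.Theory.
Export numFieldNormedType.Exports.

Set Implicit Arguments.
Unset Strict Implicit.
Unset Printing Implicit Defensive.

Local Open Scope classical_set_scope.
Local Open Scope ring_scope.

(** [P] is a standard (Lebesgue-Rokhlin) probability: off a null set [N], the
    map [f] is an isomorphism onto a subset of a Polish space [X] carrying the
    law of [f]. Images of measurable sets are only required to lie in the
    completion of the Borel sets of [X] (they are sandwiched between Borel
    sets [B1] and [B2] that differ by a set of measure zero), so that both
    standard Borel spaces and their completions qualify. *)
Definition standard_probability (R : realType) (d : measure_display)
    (J : measurableType d) (P : probability J R) : Prop :=
  exists (X : completePseudoMetricType R) (N : set J) (f : J -> X),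
    let borel : set (set X) := <<s @open X >> in
    [/\ hausdorff_space X /\ @second_countable X,
        measurable N /\ P N = 0%E,
        set_inj (~` N) f,
        forall B, borel B -> measurable (~` N `&` f @^-1` B)
      & forall A, measurable A -> A `<=` ~` N ->
          exists B1 B2, [/\ borel B1, borel B2,
            B1 `<=` f @` A, f @` A `<=` B2
          & P (~` N `&` f @^-1` (B2 `\` B1)) = 0%E]].

Record is_graphon (R : realType) (d : measure_display) (J : measurableType d)
    (P : probability J R) (W : J -> J -> R) : Prop := IsGraphon {
  graphon_standard : standard_probability P ;
  graphon_measurable : measurable_fun [set: J * J] (fun z => W z.1 z.2) ;
  graphon_sym : forall x y, W x y = W y x ;
  graphon_range : forall x y, 0 <= W x y <= 1 }.

Record bigraph : Type := Bigraph {
  bg_left : finType ;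
  bg_right : finType ;
  bg_edges : {set bg_left * bg_right} }.

Definition bg_order (F : bigraph) : nat := (#|bg_left F| + #|bg_right F|)%N.

Section power_probability.
Context (d : measure_display) (J : measurableType d) (R : realType).

Definition tcons (n : nat) (z : J * n.-tuple J) : n.+1.-tuple J :=
  [tuple of z.1 :: z.2].

Lemma measurable_tcons n : measurable_fun setT (@tcons n).
Proof. exact: measurable_cons. Qed.

HB.instance Definition _ n :=
  @isMeasurableFun.Build _ _ _ _ (@tcons n) (@measurable_tcons n).

(** The [n]-fold product probability on [J^n]. *)
Fixpoint power_probability (P : probability J R) (n : nat) :
    probability (n.-tuple J) R :=
  match n with
  | 0%N => \d_([tuple] : 0.-tuple J)
  | m.+1 => distribution (P \x power_probability P m)%E (@tcons m)
  end.

End power_probability.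

Section thin.
Context (R : realType) (d : measure_display) (J : measurableType d).
Implicit Types (P : probability J R) (W : J -> J -> R).

(** Points of [J^U] are tuples indexed by the ranks of the elements of [U]. *)
Definition coord (U : finType) (x : #|U|.-tuple J) (i : U) : J :=
  tnth x (enum_rank i).

Definition tind_integrand (F : bigraph) W
    (x : #|bg_left F|.-tuple J) (y : #|bg_right F|.-tuple J) : R :=
  (\prod_(e in bg_edges F) W (coord x e.1) (coord y e.2)) *
  (\prod_(e in ~: bg_edges F) (1 - W (coord x e.1) (coord y e.2))).

Definition tind (F : bigraph) P W : \bar R :=
  (\int[power_probability P #|bg_left F|]_x
    \int[power_probability P #|bg_right F|]_y
      (@tind_integrand F W x y)%:E)%E.

Definition thin P W : Prop := exists F : bigraph, tind F P W = 0%E.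

End thin.

Section regularity_partition.
Context (R : realType) (d : measure_display) (J : measurableType d).
Implicit Types (P : probability J R) (W : J -> J -> R) (Q : set (set J)).

Definition measurable_partition P Q : Prop :=
  partition Q id [set: J] /\
  (forall A, Q A -> measurable A /\ (0 < P A)%E).

Definition block_average P W (A B : set J) : R :=
  (\int[(P \x P)%E]_(z in A `*` B) W z.1 z.2) / (fine (P A) * fine (P B)).

(** [pblock Q id x] is the class of [x] in [Q]. *)
Definition stepping P W Q (x y : J) : R :=
  block_average P W (pblock Q id x) (pblock Q id y).

Definition ultra_strong_partition P W (eps : R) Q : Prop :=
  measurable_partition P Q /\
  (\int[P \x P]_z `|W z.1 z.2 - stepping P W Q z.1 z.2|%:E <= eps%:E)%E.

End regularity_partition.

(* Main.v *)
Require Import Defs.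
From mathcomp Require Import ring lra zify measurable_realfun.

(** Rows of [W] are compared by [row_dist x x' = \int |W x y - W x' y| dy]. Since the
    density of [F] vanishes, [W] is 0-1 valued almost everywhere, so rows are
    sets up to null sets. A family of [m] rows at pairwise distance at least
    [delta] is told apart by about [ln m / delta] suitably chosen columns. The
    traces of these rows cannot shatter [bg_order F] columns: the columns of
    [F], plus one more column per row of [F] to force distinct rows, would
    reproduce [F]. Sauer-Shelah then bounds [m] polynomially in [1 / delta].
    A maximal [m] for which separated [m]-tuples have positive measure yields
    [m] balls of radius [delta] covering almost all of [J]; these balls are
    made into a partition. On its blocks [W] is close in [L1] to a step
    function, hence, up to a factor 2, to its block averages. *)

Set Implicit Arguments.
Unset Strict Implicit.
Unset Printing Implicit Defensive.

Local Open Scope nat_scope.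

(** * Shattering, and the numerical bound drawn from it *)

(** The bound [s.+1 ^ d] replaces the usual sum of binomials; the induction closes because
    [s.+1 ^ d.+1 + s.+1 ^ d <= s.+2 ^ d.+1]. As [b] is arbitrary, [f] is automatically injective. *)
Lemma sauer_shelah (s d : nat) (A : {set s.-tuple bool}) :
  s.+1 ^ d < #|A| ->
  exists f : 'I_d -> 'I_s, forall b : 'I_d -> bool,
    exists2 a, a \in A & forall k, tnth a (f k) = b k.
Proof.
elim: s d A => [|s IH] d A ltA.
  by have := leq_trans ltA (max_card _); rewrite card_tuple expn0 ltnNge expn_gt0.
case: d ltA => [|d] ltA.
  have [a aA] : exists a, a \in A by apply/card_gt0P/(leq_trans _ ltA).
  have f : 'I_0 -> 'I_s.+1 by case.
  by exists f => b; exists a => // -[].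
(* Drop the first column: if many traces survive, they shatter [d + 1] of the
   other columns; otherwise many traces extend in both ways, so the first column
   can be added to [d] shattered ones. *)
pose A_ (c : bool) : {set s.-tuple bool} := [set t : s.-tuple bool | cons_tuple c t \in A].
have cardA : #|A| = #|A_ false| + #|A_ true|.
  have conK c : injective (@cons_tuple s bool c).
    by move=> t u /(congr1 val) [] /val_inj.
  rewrite -(card_imset (A_ false) (conK false)) -(card_imset (A_ true) (conK true)).
  rewrite -cardsUI [X in _ + X](_ : _ = 0) ?addn0; last first.
    apply/eqP; rewrite cards_eq0 -finset.subset0; apply/fintype.subsetP => t.
    by case/setIP => /imsetP[u _ ->] /imsetP[v _] /(congr1 val).
  congr #|pred_of_set _|; apply/setP => t; rewrite inE; apply/idP/orP.
    by rewrite [t]tuple_eta; case: (thead t) => tA; [right|left]; apply/imsetP;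
      exists [tuple of behead t]; rewrite ?inE //; apply: val_inj.
  by case=> /imsetP[u]; rewrite inE => uA ->.
have [ltU|leU] := ltnP (s.+1 ^ d.+1) #|A_ false :|: A_ true|.
  have [f fP] := IH _ _ ltU; exists (lift ord0 \o f) => b.
  have [a] := fP b; rewrite !inE => aA Ea.
  have [c cA] : exists c, cons_tuple c a \in A.
    by case/orP: aA => ?; [exists false|exists true].
  by exists (cons_tuple c a) => // k; rewrite /= tnthS.
have ltI : s.+1 ^ d < #|A_ false :&: A_ true|.
  rewrite -(ltn_add2l #|A_ false :|: A_ true|) cardsUI -cardA (leq_ltn_trans _ ltA) //.
  rewrite (leq_trans (leq_add leU (leqnn _))) // expnS -mulSnr expnS leq_mul //.
  by case: (d) => // e; rewrite leq_exp2r.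
have [f fP] := IH _ _ ltI.
exists (fun k => if unlift ord0 k is Some j then lift ord0 (f j) else ord0) => b.
have [a] := fP (fun k => b (lift ord0 k)); rewrite !inE => /andP[aF aT] Ea.
exists (cons_tuple (b ord0) a); first by case: (b ord0).
by move=> k; case: unliftP => [j|] ->; rewrite ?tnthS ?Ea.
Qed.

Local Open Scope classical_set_scope.
Local Open Scope ring_scope.

(** For [u] the [2 * n]-th root of [m > 0], [ln m] is at most [2 * n * u], so some [s] linear in
    [u / delta] is large enough, while [m <= s.+1 ^ n] reads [u ^ 2 <= s.+1]. The exponent [2 * n]
    thus absorbs the logarithm. *)
Lemma sampling_size_bound (R : realType) (m n : nat) (delta : R) :
  (0 < n)%N -> 0 < delta <= 1 ->
  (forall s, m%:R ^+ 2 * (1 - delta) ^+ s < 1 -> (m <= s.+1 ^ n)%N) ->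
  m%:R <= ((4 * n + 2)%:R / delta) ^+ (2 * n).
Proof.
move=> n0 /andP[d0 d1] ms.
have [->|m0] := posnP m; first by rewrite exprn_ge0 // divr_ge0 // ltW.
have n2 : (0 < 2 * n)%N by rewrite muln_gt0.
(* For [s] about [4 n u / delta], [(1 - delta) ^ s < u ^ (- 4 n) = m ^ (- 2)]. *)
pose u : R := m%:R `^ (2 * n)%:R^-1.
have u_ge0 : 0 <= u by exact: powR_ge0.
have um : u ^+ (2 * n) = m%:R.
  by rewrite -powR_mulrn // -powRrM mulVf ?powRr1 // pnatr_eq0 -lt0n.
have u1 : 1 <= u by rewrite -(@ler_pXn2r _ (2 * n)) ?nnegrE // um expr1n ler1n.
pose x := (4 * n)%:R * u / delta.
have x0 : 0 <= x by rewrite divr_ge0 ?mulr_ge0 // ltW.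
have /andP[sx xs] := truncn_itv x0; set s := (Num.truncn x).+1 in xs.
have : (m <= s.+1 ^ n)%N.
  apply: ms; rewrite -um -exprM.
  have E : (1 - delta) ^+ s < (expR u ^+ (4 * n))^-1.
    apply: (@le_lt_trans _ _ (expR (- delta) ^+ s)).
      rewrite lerXn2r ?nnegrE ?subr_ge0 ?expR_ge0 //.
      exact: expR_ge1Dx.
    rewrite -!expRM_natl -expRN ltr_expR mulrN ltrN2.
    by rewrite -ltr_pdivrMr.
  apply: (@lt_trans _ _ (u ^+ (2 * n * 2) * (expR u ^+ (4 * n))^-1)).
    by rewrite ltr_pM2l // exprn_gt0 // (lt_le_trans ltr01).
  rewrite ltr_pdivrMr ?exprn_gt0 ?expR_gt0 // mul1r.
  rewrite (_ : (2 * n * 2 = 4 * n)%N); last by rewrite mulnAC.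
  rewrite ltr_pXn2r ?nnegrE ?expR_ge0 ?muln_gt0 //.
  by apply: lt_le_trans (expR_ge1Dx u); rewrite ltrDr.
move=> ms'; have {ms'} : u ^+ 2 <= s.+1%:R.
  by rewrite -(@ler_pXn2r _ n) ?nnegrE ?exprn_ge0 // -exprM um -natrX ler_nat.
(* Since [1 <= u] and [delta <= 1], [s.+1 <= x + 2 <= (4 * n + 2) * u / delta]; one factor [u] then
   cancels. *)
move=> us; have {us} uB : u <= (4 * n + 2)%:R / delta.
  rewrite -(@ler_pM2l _ u) ?(lt_le_trans ltr01) // -expr2 (le_trans us) //.
  have -> : u * ((4 * n + 2)%:R / delta) = x + 2 * (u / delta).
    by rewrite /x natrD; lra.
  rewrite /s -addn2 natrD lerD // ler_peMr //.
  by rewrite ler_pdivlMr // mul1r (le_trans d1).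
by rewrite -um lerXn2r ?nnegrE // divr_ge0 // ltW.
Qed.

(** * Null sets, averages and Tonelli *)

Section measure_lemmas.
Context (R : realType) (d : measure_display) (T : measurableType d).

Lemma ge0_integral_eq0_ae (mu : {measure set T -> \bar R}) (D : set T)
    (f : T -> \bar R) : measurable D -> measurable_fun D f ->
  (forall x, D x -> (0 <= f x)%E) -> (\int[mu]_(x in D) f x = 0)%E ->
  {ae mu, forall x, D x -> f x = 0%E}.
Proof.
move=> mD mf f0 If; apply: (iffLR (ae_eq_integral_abs mu mD mf)).
by rewrite -[RHS]If; apply: eq_integral => x /set_mem Dx; rewrite gee0_abs ?f0.
Qed.

Lemma ae_notin (mu : {measure set T -> \bar R}) (A : set T) :
  measurable A -> mu A = 0%E -> {ae mu, forall x, ~ A x}.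
Proof. by move=> mA A0; exists A; split => // x /= /contrapT. Qed.

Lemma ae_exists (P : probability T R) (D : set T) (Q : T -> Prop) :
  measurable D -> (0 < P D)%E -> {ae P, forall x, Q x} -> exists2 x, D x & Q x.
Proof.
move=> mD D0 aeQ; apply: contrapT => nQ; move: D0.
rewrite (measure_negligible mD) ?ltxx //.
by apply: negligibleS aeQ => x Dx Qx; apply: nQ; exists x.
Qed.

Lemma ae_forall_fin (mu : {measure set T -> \bar R}) (I : finType)
    (Q : I -> T -> Prop) :
  (forall i, {ae mu, forall x, Q i x}) -> {ae mu, forall x, forall i, Q i x}.
Proof.
move=> aeQ.
have : {ae mu, forall x, forall i, i \in enum I -> Q i x}.
  elim: (enum I) => [|i s IH]; first by apply: aeW.
  apply: filterS2 IH (aeQ i) => x Qs Qi k; rewrite inE => /predU1P[->|/Qs] //.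
by apply: filterS => x Qx i; apply: Qx; rewrite mem_enum.
Qed.

(** Otherwise the excess of [f] over its mean would be positive almost everywhere on [A] and yet
    integrate to zero. Multiplying by [P A] instead of dividing also covers an infinite integral. *)
Lemma exists_le_average (P : probability T R) (A : set T) (Q : T -> Prop)
    (f : T -> \bar R) : measurable A -> (0 < P A)%E ->
  {ae P, forall x, Q x} -> measurable_fun A f -> (forall x, A x -> (0 <= f x)%E) ->
  exists x, [/\ A x, Q x & (f x * P A <= \int[P]_(x in A) f x)%E].
Proof.
move=> mA A0 aeQ mf f0; apply: contrapT => nf.
have lt_f x : A x -> Q x -> (\int[P]_(x in A) f x < f x * P A)%E.
  by move=> Ax Qx; rewrite ltNge; apply/negP => le_f; apply: nf; exists x.
have [x0 Ax0 Qx0] := ae_exists mA A0 aeQ.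
have PAfin : P A \is a fin_num by exact: fin_num_measure.
have Ifin : (\int[P]_(x in A) f x)%E \is a fin_num.
  rewrite ge0_fin_numE ?integral_ge0 //.
  by rewrite (lt_le_trans (lt_f _ Ax0 Qx0)) // leey.
pose p := fine (P A); pose c := fine (\int[P]_(x in A) f x).
have PAE : P A = p%:E by rewrite fineK.
have IE : (\int[P]_(x in A) f x = c%:E)%E by rewrite fineK.
have p0 : 0 < p by rewrite -lte_fin -PAE.
have c0 : 0 <= c by rewrite -lee_fin -IE integral_ge0.
have a0 : (0 <= (c / p)%:E)%E by rewrite lee_fin divr_ge0 // ltW.
have lt_af x : A x -> Q x -> ((c / p)%:E < f x)%E.
  by move=> Ax Qx; have := lt_f x Ax Qx; rewrite IE PAE EFinM lte_pdivrMr.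
(* Truncation keeps the excess nonnegative at the exceptional points where [Q] fails. *)
pose g x := maxe 0%E (f x - (c / p)%:E)%E.
have mg : measurable_fun A g.
  by apply: measurable_maxe => //; apply: emeasurable_funB.
have g0 x : (0 <= g x)%E by rewrite /g le_max lexx.
have Ig : (\int[P]_(x in A) g x = 0)%E.
  have : (\int[P]_(x in A) ((c / p)%:E + g x) <= c%:E)%E.
    rewrite -IE; apply: ae_ge0_le_integral => //.
    - by move=> x _; rewrite adde_ge0.
    - by apply: emeasurable_funD.
    apply: filterS aeQ => x Qx Ax; have fx := lt_af x Ax Qx.
    rewrite /g max_r; last by rewrite sube_ge0 // ltW.
    by rewrite addeC subeK.
  rewrite ge0_integralD // integral_cst //= PAE -EFinM divfK ?gt_eqF //.
  rewrite -[leRHS]adde0 leeD2lE // => I0.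
  by apply/eqP; rewrite eq_le I0 integral_ge0.
have aeg := ge0_integral_eq0_ae mA mg (fun x _ => g0 x) Ig.
have [x Ax [gx Qx]] := ae_exists mA A0 (filterI aeg aeQ).
have := lt_af x Ax Qx; rewrite -sube_gt0 => fx0; have := gx Ax.
by rewrite /g max_r ?(ltW fx0) // => fx; rewrite fx ltxx in fx0.
Qed.

End measure_lemmas.

(** By Tonelli both iterated integrals of the indicator of [H] vanish. *)
Lemma ae_ysection0 (R : realType) (d1 d2 : measure_display)
    (T1 : measurableType d1) (T2 : measurableType d2)
    (P1 : probability T1 R) (P2 : probability T2 R) (H : set (T1 * T2)) :
  measurable H -> {ae P1, forall x, P2 (xsection H x) = 0%E} ->
  {ae P2, forall y, P1 (ysection H y) = 0%E}.
Proof.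
move=> mH aeH.
have := @ge0_integral_eq0_ae _ _ _ P2 setT (P1 \o ysection H) measurableT.
move=> /(_ (measurable_fun_ysection _ mH) (fun _ _ => measure_ge0 _ _)) H0.
have {H0} : {ae P2, forall y, setT y -> (P1 \o ysection H) y = 0%E}.
  apply: H0; rewrite -indic_fubini_tonelli_GE // -indic_fubini_tonelli //.
  rewrite indic_fubini_tonelli_FE //.
  rewrite (ge0_ae_eq_integral (g := cst 0%E)) ?integral0 //.
    exact: measurable_fun_xsection.
  by apply: filterS aeH.
by apply: filterS => y; apply.
Qed.

(** * Maps with finitely many values, and means over their classes *)

Section finite_classes.
Context (R : realType) (d : measure_display) (T : measurableType d).

Lemma measurable_finite_bits (I : finType) (b : I -> T -> bool)
    (g : {ffun I -> bool} -> Prop) :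
  (forall i, measurable [set x | b i x]) -> measurable [set x | g [ffun i => b i x]].
Proof.
move=> mb; rewrite (_ : [set x | _] = \bigcup_(beta in [set beta | g beta])
    \bigcap_(i in [set: I]) [set x | b i x = beta i]).
  apply: fin_bigcup_measurable => // beta _; apply: fin_bigcap_measurable => // i _.
  case: (beta i); first exact: mb.
  rewrite (_ : [set x | _] = ~` [set x | b i x]); first exact: measurableC.
  by apply/seteqP; split=> x /=; [move=> ->|move/negP/negbTE].
apply/seteqP; split=> x /=.
  by move=> gx; exists [ffun i => b i x] => //= i _; rewrite ffunE.
by move=> [beta /= gb bx]; congr g: gb; apply/ffunP => i; rewrite ffunE bx.
Qed.

Variables (I : finType) (c : T -> I).
Hypothesis mc : forall i, measurable (c @^-1` [set i]).

Lemma measurable_fun_finite_classes d' (T' : measurableType d') (h : I -> T') :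
  measurable_fun setT (fun x => h (c x)).
Proof.
move=> _ Y _; rewrite setTI.
rewrite (_ : _ @^-1` Y = \bigcup_(i in [set i | Y (h i)]) (c @^-1` [set i])).
  by apply: fin_bigcup_measurable.
by apply/seteqP; split=> [x Yx|x [i /= Yi ->]//]; exists (c x).
Qed.

Lemma ge0_integral_classes (mu : {measure set T -> \bar R}) (f : T -> \bar R) :
  measurable_fun setT f -> (forall x, (0 <= f x)%E) ->
  (\int[mu]_x f x = \sum_i \int[mu]_(x in c @^-1` [set i]) f x)%E.
Proof.
move=> mf f0.
have cT : \big[setU/set0]_(i <- enum I) (c @^-1` [set i]) = setT.
  apply/seteqP; split=> // x _; rewrite -bigcup_seq; exists (c x) => //=.
  by rewrite mem_enum.
rewrite -[in LHS]cT ge0_integral_bigsetU ?enum_uniq ?cT //; first by rewrite big_enum.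
by apply/trivIsetP => i k _ _ ik; apply/seteqP; split=> // x [/= ci ck]; rewrite -ci -ck eqxx in ik.
Qed.

End finite_classes.

(** The mean differs from [v] by at most the average of [|f - v|] over [D]; the triangle inequality
    through [v] adds a second copy of the same integral. *)
Lemma integral_dist_mean (R : realType) (d : measure_display) (T : measurableType d)
    (M : probability T R) (D : set T) (f : T -> R) (v : R) :
  measurable D -> measurable_fun setT f -> (forall x, 0 <= f x <= 1) ->
  (\int[M]_(x in D) `|f x - (\int[M]_(t in D) f t)%R / fine (M D)|%:E
    <= 2%:E * \int[M]_(x in D) `|f x - v|%:E)%E.
Proof.
move=> mD mf f01; set p := fine (M D); set a := (_ / p)%R.
have mfD : measurable_fun D f by exact: measurable_funS mf.
have mabs k : measurable_fun D (fun x => `|f x - k|%:E).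
  by apply/measurable_EFinP; apply: measurableT_comp => //; exact: measurable_funB.
have [M0|M0] := eqVneq (M D) 0%E.
  by rewrite !(null_set_integral mD _ M0) ?mule0.
have MDfin : M D \is a fin_num by exact: fin_num_measure.
have p0 : 0 < p by rewrite fine_gt0 // lt0e M0 measure_ge0 -ge0_fin_numE.
have intf : M.-integrable D (EFin \o f).
  apply: measurable_bounded_integrable => //; first by rewrite -ge0_fin_numE.
  exists 1; split => // y y1 x _ /=; have /andP[fx0 fx1] := f01 x.
  by rewrite ger0_norm // (le_trans fx1) // ltW.
have intc (k : R) : M.-integrable D (EFin \o cst k).
  by apply: finite_measure_integrable_cst.
have va : (`|v - a|%:E * M D <= \int[M]_(x in D) `|f x - v|%:E)%E.
  have -> : (`|v - a|%:E * M D = `|\int[M]_(x in D) (f x - v)|%R%:E)%E.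
    have -> : (\int[M]_(x in D) (f x - v) = \int[M]_(x in D) f x - v * p)%R.
      apply: etrans (RintegralB mD intf (intc v)) _; congr (_ - _).
      exact: (Rintegral_cst M mD v).
    rewrite -(fineK MDfin) -EFinM -/p.
    congr EFin; rewrite -[X in _ * X]ger0_norm ?ltW // -normrM distrC mulrBl.
    by rewrite /a divfK ?gt_eqF.
  have intfv : M.-integrable D (EFin \o (fun x => f x - v)).
    by have := integrableB mD intf (intc v).
  rewrite EFin_normr_Rintegral //; apply: le_abse_integral => //.
  by apply: measurable_int intfv.
apply: (@le_trans _ _ (\int[M]_(x in D) (`|f x - v|%:E + `|v - a|%:E))%E).
  apply: ge0_le_integral => //.
  - by apply: emeasurable_funD.
  - by move=> x _; rewrite -EFinD lee_fin ler_distD.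
rewrite ge0_integralD // integral_cst //=.
by rewrite (_ : 2 = 1 + 1) // EFinD ge0_muleDl // !mul1e leeD.
Qed.

(** * The product measure on tuples: boxes and marginals *)

Section power_probability_theory.
Context (R : realType) (d : measure_display) (J : measurableType d).
Variable P : probability J R.

Definition cylinder n (A : 'I_n -> set J) : set (n.-tuple J) :=
  [set x | forall i, A i (tnth x i)].

Lemma measurable_cylinder n (A : 'I_n -> set J) :
  (forall i, measurable (A i)) -> measurable (cylinder A).
Proof.
move=> mA; rewrite (_ : cylinder A =
    \bigcap_(i in [set: 'I_n]) ((@tnth n J ^~ i) @^-1` A i)); last first.
  by apply/seteqP; split=> [x Ax i _|x Ax i]; [exact: Ax|exact: Ax].
apply: fin_bigcap_measurable => // i _.
by have := measurable_tnth i measurableT (mA i); rewrite setTI.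
Qed.

Lemma power_probability_cylinder n (A : 'I_n -> set J) :
  (forall i, measurable (A i)) ->
  power_probability P n (cylinder A) = (\prod_(i < n) P (A i))%E.
Proof.
elim: n A => [|n IH] A mA.
  by rewrite big_ord0 /= diracE mem_set // => -[].
pose A' (i : 'I_n) := A (lift ord0 i).
have mA' : measurable (cylinder A') by apply: measurable_cylinder => i; exact: mA.
rewrite big_ord_recl /= /pushforward.
have -> : (@tcons d J n) @^-1` cylinder A = A ord0 `*` cylinder A'.
  apply/seteqP; split=> [[x t] /= Axt|[x t] /= [A0 At] i /=].
    by split=> [|i]; [have := Axt ord0|have := Axt (lift ord0 i); rewrite tnthS].
  by case: (unliftP ord0 i) => [j|] -> //; rewrite tnthS; exact: At.
rewrite [LHS]product_measure1E //; congr (mule _ _).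
by apply: IH => i; exact: mA.
Qed.

Definition select m n (f : 'I_n -> 'I_m) (x : m.-tuple J) : n.-tuple J :=
  [tuple tnth x (f i) | i < n].

Lemma measurable_select m n (f : 'I_n -> 'I_m) : measurable_fun setT (select f).
Proof.
apply/measurable_fun_tnthP => i.
rewrite (_ : _ \o _ = @tnth m J ^~ (f i)); first exact: measurable_tnth.
by apply/funext => x /=; rewrite tnth_mktuple.
Qed.

Let cylinders n : set (set (n.-tuple J)) :=
  [set B | exists2 A, (forall i, measurable (A i)) & B = cylinder A].

(** A condition on one coordinate is a box with [setT] elsewhere. Boxes are stable under
    intersection, as uniqueness of measures requires. *)
Let measurable_cylinders n : @measurable _ (n.-tuple J) = <<s @cylinders n >>.
Proof.
apply/seteqP; split.
- apply: smallest_sub; first exact: smallest_sigma_algebra.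
  case: n => [|n]; first by rewrite big_ord0.
  rewrite -bigcup_mkord_ord; apply: bigcup_sub => i Ii B [A mA <-].
  apply: sub_sigma_algebra; exists (fun k => if k == inord i then A else setT).
    by move=> k; case: ifP.
  rewrite setTI; apply/seteqP; split=> x /=; last by move/(_ (inord i)); rewrite eqxx.
  by move=> Ax k; case: eqP => // ->.
- apply: smallest_sub; first exact: sigma_algebra_measurable.
  by move=> _ [A mA ->]; exact: measurable_cylinder.
Qed.

(** Distinct coordinates are independent of law [P], so the two measures agree on boxes. Repeated
    coordinates would confine the selected tuple to a diagonal, hence the injectivity. *)
Lemma power_probability_select m n (f : 'I_n -> 'I_m) (B : set (n.-tuple J)) :
  injective f -> measurable B ->
  power_probability P m (select f @^-1` B) = power_probability P n B.
Proof.
move=> fI mB; pose F : {mfun _ >-> _} := mfun_Sub (mem_set (measurable_select f)).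
rewrite -[LHS]/(distribution (power_probability P m) F B).
apply: (measure_unique (@cylinders n) (fun=> setT)) => //.
- exact: measurable_cylinders.
- move=> _ _ [A mA ->] [A' mA' ->]; exists (fun i => A i `&` A' i).
    by move=> i; exact: measurableI.
  by apply/seteqP; split=> [x [Ax A'x] i|x AA']; split=> // i; have [] := AA' i.
- by move=> _; exists (fun=> setT) => //; apply/seteqP; split.
- by rewrite bigcup_const.
- move=> _ [A mA ->]; apply: etrans (esym (power_probability_cylinder mA)).
  (* Coordinate [f i] must lie in [A i]; the other coordinates are free and contribute factors 1. *)
  pose A' (j : 'I_m) := if [pick i | f i == j] is Some i then A i else setT.
  have mA' j : measurable (A' j) by rewrite /A'; case: pickP.
  have fA : select f @^-1` cylinder A = cylinder A'.
    apply/seteqP; split=> [x xA j|x xA i] /=.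
      rewrite /A'; case: pickP => // i /eqP <-.
      by have := xA i; rewrite tnth_mktuple.
    have := xA (f i); rewrite /A' tnth_mktuple.
    by case: pickP => [k /eqP /fI ->|/(_ i)] //; rewrite eqxx.
  rewrite -[LHS]/(power_probability P m (select f @^-1` cylinder A)) fA.
  apply: etrans (power_probability_cylinder mA') _.
  rewrite (bigID [in codom f]) /= [X in (_ * X)%E]big1 //; last first.
    move=> j jf; rewrite /A'; case: pickP => [i /eqP fi|_]; last exact: probability_setT.
    by rewrite -fi codom_f in jf.
  rewrite mule1 -big_uniq; last exact/injectiveP.
  rewrite codomE big_map big_enum /=.
  apply: eq_bigr => i _; rewrite /A'; case: pickP => [k /eqP /fI -> //|/(_ i)].
  by rewrite eqxx.
- by move=> k; rewrite (le_lt_trans (probability_le1 _ _)) ?ltry.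
Qed.
End power_probability_theory.

(** * Sampling points that hit many sets *)

(** Each new point cuts the number of missed sets by a factor [1 - delta]. The sets will be the
    differences between two rows: once the bound is below 1, all pairs of rows are told apart. *)
Lemma exists_hitting_points (R : realType) (d : measure_display)
    (T : measurableType d) (P : probability T R) (I : finType) (D : I -> set T)
    (Q : T -> Prop) (delta : R) (A : {set I}) (s : nat) :
  (forall i, measurable (D i)) -> {ae P, forall x, Q x} -> delta <= 1 ->
  (forall i, i \in A -> (delta%:E <= P (D i))%E) ->
  exists2 ys : s.-tuple T, (forall k, Q (tnth ys k)) &
    #|[set i in A | all (fun y => y \notin D i) ys]%SET|%:R
      <= #|A|%:R * (1 - delta) ^+ s.
Proof.
move=> mD aeQ d1; elim: s A => [|s IH] A AD.
  exists [tuple] => [[]//|]; rewrite expr0 mulr1 ler_nat subset_leq_card //.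
  by apply/fintype.subsetP => i; rewrite inE => /andP[].
(* Greedy choice: some [y] misses at most the average number of the [D i]. *)
pose f y := (\sum_(i <- enum A) (\1_(~` D i) y : R)%:E)%E.
have mi i : measurable_fun setT (EFin \o (\1_(~` D i) : T -> R)).
  by apply/measurable_EFinP; apply: measurable_indic; exact: measurableC.
have mf : measurable_fun setT f.
  exact: emeasurable_sum.
have f0 y : setT y -> (0 <= f y)%E by move=> _; apply: sume_ge0 => i _; rewrite lee_fin.
have [|y [_ Qy]] := exists_le_average (P := P) measurableT _ aeQ mf f0.
  by rewrite probability_setT.
rewrite probability_setT mule1 => fy.
have {}fy : (f y <= (#|A|%:R * (1 - delta))%:E)%E.
  apply: (le_trans fy); rewrite /f.
  rewrite ge0_integral_sum //.
  rewrite big_enum /= (le_trans (y := (\sum_(i in A) (1 - delta)%:E)%E)) //.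
    apply: lee_sum => i iA; rewrite integral_indic ?setIT //; last exact: measurableC.
    by rewrite [X in (X <= _)%E](probability_setC P (mD i)) EFinB leeB // AD.
  by rewrite sumEFin sumr_const mulr_natl.
pose A' := [set i in A | y \notin D i]%SET.
have fyE : f y = #|A'|%:R%:E.
  rewrite /f big_enum sumEFin; congr EFin; rewrite -sum1_card natr_sum.
  rewrite [in RHS]big_mkcond [in LHS]big_mkcond /=; apply: eq_bigr => i _.
  rewrite inE indicE in_setC; case: (i \in A) => //=.
  by case: (y \in D i).
have [|ys Qys Hys] := IH A'; first by move=> i; rewrite inE => /andP[/AD].
exists (cons_tuple y ys).
  by move=> k; case: (unliftP ord0 k) => [j|] -> //; rewrite tnthS.
apply: (@le_trans _ _ (#|A'|%:R * (1 - delta) ^+ s)).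
  apply: le_trans Hys; rewrite ler_nat subset_leq_card //.
  by apply/fintype.subsetP => i; rewrite !inE /= -andbA.
rewrite exprS mulrA ler_wpM2r ?exprn_ge0 ?subr_ge0 //.
by rewrite -lee_fin -fyE.
Qed.

(** * Consequences of a vanishing density: null cells and 0-1 valued rows *)

Section graphon_regularity.
Context (R : realType) (d : measure_display) (J : measurableType d).
Variables (P : probability J R) (W : J -> J -> R) (F : bigraph).
Hypothesis Wm : measurable_fun [set: J * J] (fun z => W z.1 z.2).
Hypothesis Wsym : forall x y, W x y = W y x.
Hypothesis W01 : forall x y, 0 <= W x y <= 1.

Lemma measurable_graphon_comp d' (T : measurableType d') (f g : T -> J) :
  measurable_fun setT f -> measurable_fun setT g ->
  measurable_fun setT (fun a => W (f a) (g a)).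
Proof.
by move=> mf mg; exact: (measurableT_comp Wm (measurable_fun_pair mf mg)).
Qed.

Definition edge_weight (b : bool) (x y : J) : R :=
  if b then W x y else 1 - W x y.

Lemma edge_weight_ge0 b x y : 0 <= edge_weight b x y.
Proof. by have := W01 x y; case: b => /=; lra. Qed.

Lemma measurable_edge_weight b d' (T : measurableType d') (f g : T -> J) :
  measurable_fun setT f -> measurable_fun setT g ->
  measurable_fun setT (fun a => edge_weight b (f a) (g a)).
Proof.
move=> mf mg; have mW := measurable_graphon_comp mf mg.
by case: b => //=; exact: measurable_funB.
Qed.

Definition fractional (x : J) : set J := [set y | 0 < W x y < 1].

Lemma measurable_fractional x : measurable (fractional x).
Proof.
have := measurable_graphon_comp (@measurable_cst _ _ J J setT x) (@measurable_id _ J setT).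
move=> /(_ measurableT `]0, 1[%classic (measurable_itv _)); rewrite setTI.
by congr measurable; apply/seteqP; split=> y /=; rewrite in_itv.
Qed.

(** Up to a null set, the [y] that may play the role of [j] in a copy of [F] whose
    left side is [v]. *)
Definition cell (v : bg_left F -> J) (j : bg_right F) : set J :=
  [set y | forall i, 0 < edge_weight ((i, j) \in bg_edges F) (v i) y].

Lemma measurable_cell v j : measurable (cell v j).
Proof.
rewrite (_ : cell v j = \bigcap_(i in [set: bg_left F])
    (edge_weight ((i, j) \in bg_edges F) (v i) @^-1` `]0, +oo[%classic)).
  apply: fin_bigcap_measurable => // i _.
  have := measurable_edge_weight ((i, j) \in bg_edges F)
    (@measurable_cst _ _ J J setT (v i)) (@measurable_id _ J setT).
  by move=> /(_ measurableT `]0, +oo[%classic (measurable_itv _)); rewrite setTI.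
apply/seteqP; split=> [y vy i _|y vy i]; first by rewrite /= in_itv /= andbT vy.
by have := vy i I; rewrite /= in_itv /= andbT.
Qed.

Let n1 := #|bg_left F|.
Let n2 := #|bg_right F|.

Lemma tind_integrandE (x : n1.-tuple J) (y : n2.-tuple J) :
  @tind_integrand R d J F W x y =
  \prod_e edge_weight (e \in bg_edges F) (coord x e.1) (coord y e.2).
Proof.
rewrite /tind_integrand [RHS](bigID [in bg_edges F]) /=.
congr (_ * _); first by apply: eq_bigr => e ->.
rewrite (eq_bigl [predC bg_edges F]) /=; last by move=> e; rewrite !inE.
by apply: eq_bigr => e /negbTE ->.
Qed.

Lemma measurable_tind_integrand :
  measurable_fun setT (fun z : n1.-tuple J * n2.-tuple J =>
    @tind_integrand R d J F W z.1 z.2).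
Proof.
under eq_fun do rewrite tind_integrandE.
apply: measurable_prod => e _; apply: measurable_edge_weight.
- exact: (measurableT_comp (measurable_tnth _) measurable_fst).
- exact: (measurableT_comp (measurable_tnth _) measurable_snd).
Qed.

Lemma tind_integrand_ge0 (x : n1.-tuple J) (y : n2.-tuple J) :
  0 <= @tind_integrand R d J F W x y.
Proof. by rewrite tind_integrandE prodr_ge0 // => e _; exact: edge_weight_ge0. Qed.

(** For almost every [x] the inner integral is zero. If all cells had positive measure, so would
    their product, on which the integrand is positive. *)
Lemma ae_cell_null : tind F P W = 0%E ->
  {ae power_probability P n1, forall x : n1.-tuple J,
    exists j, P (cell (coord x) j) = 0%E}.
Proof.
move=> F0.
have mI : measurable_fun setT (EFin \o (fun z : n1.-tuple J * n2.-tuple J =>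
    @tind_integrand R d J F W z.1 z.2)).
  by apply/measurable_EFinP; exact: measurable_tind_integrand.
have I0 z : (0 <= (EFin \o (fun z : n1.-tuple J * n2.-tuple J =>
    @tind_integrand R d J F W z.1 z.2)) z)%E.
  by rewrite lee_fin tind_integrand_ge0.
have := @ge0_integral_eq0_ae _ _ _ (power_probability P n1) setT _ measurableT
  (measurable_fun_fubini_tonelli_F (m2 := power_probability P n2) _ mI I0).
move=> /(_ (fun x _ => integral_ge0 _ (fun y _ => I0 (x, y))) F0).
apply: filterS => x /(_ I) Ix; apply: contrapT => nx.
pose A (k : 'I_n2) := cell (coord x) (enum_val k).
have mA k : measurable (A k) by exact: measurable_cell.
have A0 : (0 < power_probability P n2 (cylinder A))%E.
  rewrite [ltRHS]power_probability_cylinder //; apply: (big_ind (fun u => 0 < u)%E) => // [u v|k _]; first exact: mule_gt0.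
  rewrite lt0e measure_ge0 andbT; apply/eqP => Ak.
  by apply: nx; exists (enum_val k).
have mIx := measurableT_comp mI (pair1_measurable x).
have := @ge0_integral_eq0_ae _ _ _ (power_probability P n2) setT _ measurableT mIx
  (fun y _ => I0 (x, y)) Ix.
move=> /(ae_exists (measurable_cylinder mA) A0) [y Ay /(_ I) /eqP].
rewrite /= eqe tind_integrandE gt_eqF // prodr_gt0 // => -[i j] _ /=.
by have := Ay (enum_rank j) i; rewrite enum_rankK.
Qed.

(** A column at which all rows of [x] lie strictly between 0 and 1 belongs to every cell, so for
    almost every [x] such columns form a null set. After exchanging variables, a power of
    [P (fractional y)] vanishes for almost every [y]. *)
Lemma ae_not_fractional : tind F P W = 0%E ->
  {ae P, forall x, P (fractional x) = 0%E}.
Proof.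
move=> /ae_cell_null ae0.
pose H : set (n1.-tuple J * J) := \bigcap_(i in [set: bg_left F])
  ((fun z => W (coord z.1 i) z.2) @^-1` `]0, 1[%classic).
have mH : measurable H.
  apply: fin_bigcap_measurable => // i _.
  have mc : measurable_fun setT (fun z : n1.-tuple J * J => coord z.1 i).
    exact: (measurableT_comp (measurable_tnth _) measurable_fst).
  have := measurable_graphon_comp mc measurable_snd.
  by move=> /(_ measurableT `]0, 1[%classic (measurable_itv _)); rewrite setTI.
have aeH : {ae power_probability P n1, forall x, P (xsection H x) = 0%E}.
  apply: filterS ae0 => x [j xj]; apply: (subset_measure0 _ _ _ xj).
  - exact: measurable_xsection.
  - exact: measurable_cell.
  move=> y; rewrite xsectionE /= => Hxy i.
  have := Hxy i I; rewrite /= in_itv /= /edge_weight => /andP[W0 W1].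
  by case: ifP => _ //; rewrite subr_gt0.
have := ae_ysection0 mH aeH; apply: filterS => y Hy.
(* By symmetry of [W], the section of [H] at [y] is the [n1]-fold power of [fractional y]. *)
have : power_probability P n1 (cylinder (fun _ : 'I_n1 => fractional y)) = 0%E.
  rewrite -[RHS]Hy; congr (power_probability P n1 _).
  apply/seteqP; split=> x; rewrite ysectionE /= => xy i.
    by have := xy (enum_rank i); rewrite /= in_itv /= /coord Wsym.
  have := xy (enum_val i) I.
  by rewrite /= in_itv /= /coord enum_valK Wsym.
rewrite [LHS]power_probability_cylinder; last by move=> _; exact: measurable_fractional.
apply: contra_eq => y0; rewrite gt_eqF //; apply: (big_ind (fun u => 0 < u)%E) => // [u v|i _]; first exact: mule_gt0.
by rewrite lt0e y0 measure_ge0.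
Qed.

Hypothesis F0 : tind F P W = 0%E.

(** * Distances between rows, and the size of separated families *)

Definition row_dist (x x' : J) : \bar R := (\int[P]_y `|W x y - W x' y|%:E)%E.

Lemma row_distC x x' : row_dist x x' = row_dist x' x.
Proof. by apply: eq_integral => y _; rewrite distrC. Qed.

Lemma measurable_abs_diff d' (T : measurableType d') (f g f' g' : T -> J) :
  measurable_fun setT f -> measurable_fun setT g ->
  measurable_fun setT f' -> measurable_fun setT g' ->
  measurable_fun setT (fun a => `|W (f a) (g a) - W (f' a) (g' a)|%:E).
Proof.
move=> mf mg mf' mg'; apply/measurable_EFinP; apply: measurableT_comp => //.
by apply: measurable_funB; exact: measurable_graphon_comp.
Qed.

Lemma measurable_row_dist d' (T : measurableType d') (f g : T -> J) :
  measurable_fun setT f -> measurable_fun setT g ->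
  measurable_fun setT (fun a => row_dist (f a) (g a)).
Proof.
move=> mf mg.
apply: (measurable_fun_fubini_tonelli_F (m2 := P)
  (fun z : T * J => `|W (f z.1) z.2 - W (g z.1) z.2|%:E)) => //.
by apply: measurable_abs_diff => //;
  [exact: (measurableT_comp mf measurable_fst)
  |exact: (measurableT_comp mg measurable_fst)].
Qed.

Definition separated m (delta : R) : set (m.-tuple J) :=
  [set t | forall i k, i != k -> (delta%:E <= row_dist (tnth t i) (tnth t k))%E].

Lemma measurable_separated m delta : measurable (@separated m delta).
Proof.
rewrite (_ : separated delta = \bigcap_(p in [set p : 'I_m * 'I_m | p.1 != p.2])
    ((fun t => row_dist (tnth t p.1) (tnth t p.2)) @^-1` `[delta%:E, +oo[%classic)).
  apply: fin_bigcap_measurable => // p _; rewrite -[X in measurable X]setTI.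
  apply: measurable_row_dist => //; first [exact: measurable_tnth|exact: emeasurable_itv].
apply/seteqP; split=> [t tS [i k] /= ik|t tS i k ik].
  by rewrite in_itv /= andbT; exact: tS.
by have := tS (i, k) ik; rewrite /= in_itv /= andbT.
Qed.

(** There are finitely many conditions, each inherited from a marginal. For injective [phi] the
    selected rows again follow a product law, so [ae_cell_null] applies to them. *)
Lemma ae_generic m :
  {ae power_probability P m, forall t : m.-tuple J,
    (forall i, P (fractional (tnth t i)) = 0%E) /\
    (forall phi : {ffun bg_left F -> 'I_m}, injective phi ->
      exists j, P (cell (fun i => tnth t (phi i)) j) = 0%E)}.
Proof.
apply: filterI; apply: ae_forall_fin.
- move=> i; have [N [mN N0 fN]] := ae_not_fractional F0.
  exists ((@tnth m J ^~ i) @^-1` N); split.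
  + by have := measurable_tnth i measurableT mN; rewrite setTI.
  + rewrite (_ : _ @^-1` N = cylinder (fun k => if k == i then N else setT)).
      rewrite [LHS]power_probability_cylinder; last by move=> k; case: ifP.
      by rewrite (bigD1 i) //= eqxx N0 mul0e.
    apply/seteqP; split=> [t tN k /=|t /(_ i)]; last by rewrite eqxx.
    by case: eqP => // ->.
  + by move=> t /= nt; exact: fN.
- move=> phi.
  have [phiI|nphi] := pselect (injective phi); last by apply: aeW.
  have [N [mN N0 fN]] := ae_cell_null F0.
  pose f (k : 'I_#|bg_left F|) := phi (enum_val k).
  have fI : injective f by move=> k l /phiI /enum_val_inj.
  exists (select f @^-1` N); split.
  + by have := @measurable_select _ J _ _ f measurableT _ mN; rewrite setTI.
  + by rewrite [LHS]power_probability_select.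
  + move=> t /= nt; apply: fN => /= -[j tj]; apply: nt => _; exists j.
    rewrite -[RHS]tj; congr (P (cell _ _)); apply/funext => i.
    by rewrite /coord tnth_mktuple /f enum_rankK.
Qed.

(** On [s] sampled columns the rows have distinct traces. Too many traces would shatter columns
    indexed by both sides of [F], and a copy of [F] found there would put a sampled column into a
    null cell. *)
Lemma separated_generic_size m (t : m.-tuple J) (delta : R) s :
  delta <= 1 -> separated delta t ->
  (forall i, P (fractional (tnth t i)) = 0%E) ->
  (forall phi : {ffun bg_left F -> 'I_m}, injective phi ->
    exists j, P (cell (fun i => tnth t (phi i)) j) = 0%E) ->
  m%:R ^+ 2 * (1 - delta) ^+ s < 1 ->
  (m <= s.+1 ^ bg_order F)%N.
Proof.
move=> d1 tsep t01 tF ms.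
pose bit i y := W (tnth t i) y == 1.
pose N i : set J := [set y | bit i y].
have mN i : measurable (N i).
  have := measurable_graphon_comp (@measurable_cst _ _ J J setT (tnth t i))
    (@measurable_id _ J setT).
  move=> /(_ measurableT [set 1] (measurable_set1 1)); rewrite setTI.
  by congr measurable; apply/seteqP; split=> y /= /eqP.
pose D (p : 'I_m * 'I_m) := (N p.1 `\` N p.2) `|` (N p.2 `\` N p.1).
have mD p : measurable (D p) by apply: measurableU; exact: measurableD.
have DE p y : bit p.1 y != bit p.2 y -> D p y.
  rewrite /D /N /=; case: (bit p.1 y); case: (bit p.2 y) => // _; first by left.
  by right.
pose sub_cell (p : {ffun bg_left F -> 'I_m} * bg_right F) :=
  cell (fun i => tnth t (p.1 i)) p.2.
(* The columns fit for sampling: every row is 0 or 1 there, and no null cell contains them. *)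
pose Q y := (forall i, ~ fractional (tnth t i) y) /\
  (forall p, P (sub_cell p) = 0%E -> ~ sub_cell p y).
have bit0 i y : Q y -> bit i y = false -> W (tnth t i) y = 0.
  move=> [/(_ i) fy _] /eqP biy; apply/eqP; apply: contra_notT fy => W0.
  have /andP[Wge Wle] := W01 (tnth t i) y.
  by rewrite /fractional /= !lt_neqAle Wge Wle eq_sym W0 /= andbT; apply/eqP.
have aeQ : {ae P, forall y, Q y}.
  apply: filterI; apply: ae_forall_fin.
    by move=> i; exact: (ae_notin (measurable_fractional _) (t01 i)).
  move=> p; have [p0|np0] := pselect (P (sub_cell p) = 0%E); last exact: aeW.
  by have := ae_notin (measurable_cell _ _) p0; apply: filterS.
pose A := [set p : 'I_m * 'I_m | p.1 != p.2]%SET.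
have AD p : p \in A -> (delta%:E <= P (D p))%E.
  rewrite inE => p12; apply: (le_trans (tsep _ _ p12)).
  (* Where [Q] holds, the two rows differ by at most 1 on [D p] and agree off it. *)
  rewrite -[X in (_ <= P X)%E]setIT -integral_indic //.
  apply: ae_ge0_le_integral => //.
  - by apply: measurable_abs_diff; [exact: measurable_cst|exact: measurable_id|exact: measurable_cst|exact: measurable_id].
  - by apply/measurable_EFinP; exact: measurable_indic.
  apply: filterS aeQ => y Qy _; rewrite lee_fin indicE.
  have [Dy|nDy] := boolP (y \in D p).
    have /andP[? ?] := W01 (tnth t p.1) y; have /andP[? ?] := W01 (tnth t p.2) y.
    by rewrite mulr1n ler_norml; lra.
  have b12 : bit p.1 y = bit p.2 y.
    have [//|b12] := eqVneq (bit p.1 y) (bit p.2 y).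
    by move/negP: nDy; case; apply/mem_set; exact: DE.
  have [b1|b1] := boolP (bit p.1 y).
    by move: (b1); rewrite b12 => /eqP ->; move/eqP: b1 => ->; rewrite subrr normr0.
  rewrite (bit0 p.1 y) ?(bit0 p.2 y) ?subrr ?normr0 //; apply/negbTE => //.
  by rewrite -b12.
have [ys Qys] := exists_hitting_points s mD aeQ d1 AD.
pose B := [set p in A | all (fun y => y \notin D p) ys]%SET.
rewrite -/B => Bs.
(* There are at most [m ^ 2] pairs to begin with, so fewer than one remains unseparated. *)
have B0 : B = finset.set0.
  apply/eqP; rewrite -cards_eq0 -leqn0 -ltnS -(ltr_nat R).
  apply: (le_lt_trans Bs); apply: le_lt_trans ms.
  rewrite ler_wpM2r ?exprn_ge0 ?subr_ge0 // -natrX ler_nat.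
  by rewrite (leq_trans (max_card _)) // card_prod !card_ord mulnn.
pose a i : s.-tuple bool := [tuple bit i (tnth ys k) | k < s].
have aI : injective a.
  move=> i k aik; apply/eqP; apply: contraT => nik.
  suff : (i, k) \in B by rewrite B0 inE.
  rewrite !inE /= nik /=; apply/allP => y /tnthP [l ->].
  apply/negP; rewrite inE => Dl.
  have : tnth (a i) l = tnth (a k) l by rewrite aik.
  rewrite !tnth_mktuple => bl.
  by case: Dl => -[] /=; rewrite /N /= bl.
rewrite leqNgt; apply/negP => ltm.
have [|f fP] := @sauer_shelah s (bg_order F) [set a i | i in [set: 'I_m]]%SET.
  by rewrite card_imset // cardsT card_ord.
have ordF : bg_order F = #|{: bg_left F + bg_right F}| by rewrite card_sum.
move: f fP; rewrite ordF => f fP.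
(* The columns indexed by [inl] make the rows chosen for distinct [i] distinct. *)
pose b (i : bg_left F) (u : bg_left F + bg_right F) :=
  match u with inl i' => i' == i | inr j => (i, j) \in bg_edges F end.
have ex i : exists k, forall u, bit k (tnth ys (f (enum_rank u))) = b i u.
  have [_ /imsetP[k _ ->] Ek] := fP (fun l => b i (enum_val l)).
  by exists k => u; have := Ek (enum_rank u); rewrite tnth_mktuple enum_rankK.
have /choice [phi phiP] := ex.
have phiI : injective (finfun phi).
  move=> i i'; rewrite !ffunE => ii'; have := phiP i (inl i).
  by rewrite ii' phiP /= eqxx => /eqP.
have [j tj] := tF _ phiI.
(* This sampled column meets the rows [phi] as [j] meets the left side of [F], so it lies in a null
   cell, against [Q]. *)
pose y := tnth ys (f (enum_rank (inr j))).
have Qy : Q y by exact: Qys.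
apply: (Qy.2 (finfun phi, j) tj) => i /=; rewrite ffunE.
have := phiP i (inr j); rewrite /= -/y => bij; rewrite -bij /edge_weight.
case: ifPn => [/eqP ->|/negbTE b0]; first exact: ltr01.
by rewrite bit0 // subr0.
Qed.

(** The null cell is indexed by a node of the right side. *)
Lemma bg_order_gt0 : (0 < bg_order F)%N.
Proof.
have := ae_cell_null F0.
move=> /(ae_exists (P := power_probability P _) measurableT) [|x _ [j _]].
  by rewrite [ltRHS]probability_setT.
by rewrite /bg_order addn_gt0 orbC; apply/orP; left; apply/card_gt0P; exists j.
Qed.

Lemma separated_size (delta : R) m : 0 < delta <= 1 ->
  (0 < power_probability P m (@separated m delta))%E ->
  m%:R <= ((4 * bg_order F + 2)%:R / delta) ^+ (2 * bg_order F).
Proof.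
move=> d01 sep0; have [t tsep [t01 tF]] :=
  ae_exists (@measurable_separated m delta) sep0 (ae_generic m).
apply: sampling_size_bound => // [|s]; first exact: bg_order_gt0.
by apply: (separated_generic_size (t := t)) => //; case/andP: d01.
Qed.

(** The size bound is proved for generic tuples, which a maximal separated tuple need not be. Hence
    the maximum is taken over sizes at which separated tuples have positive measure. *)
Lemma exists_net (delta : R) : 0 < delta <= 1 ->
  exists m (t : m.-tuple J),
    m%:R <= ((4 * bg_order F + 2)%:R / delta) ^+ (2 * bg_order F) /\
    {ae P, forall x, exists i, (row_dist x (tnth t i) < delta%:E)%E}.
Proof.
move=> d01; pose bound : R := ((4 * bg_order F + 2)%:R / delta) ^+ (2 * bg_order F).
pose pos m := (0 < power_probability P m (@separated m delta))%E.
have pos0 : exists m, pos m.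
  exists 0%N; rewrite /pos (_ : separated _ = setT).
    by rewrite [ltRHS]probability_setT.
  by apply/seteqP; split=> // t _ [].
have posB m : pos m -> (m <= Num.truncn bound)%N.
  by move=> /(separated_size d01) mB; rewrite truncn_ge_nat // (le_trans _ mB).
(* By maximality almost no [(x, t)] is separated; Fubini provides a separated [t]
   with this property. *)
case: (ex_maxnP pos0 posB) => m posm maxm.
have [t tsep tnull] : exists2 t : m.-tuple J, separated delta t &
    P [set x | separated delta (tcons (x, t))] = 0%E.
  pose H : set (J * m.-tuple J) := @tcons _ J m @^-1` separated delta.
  have mH : measurable H.
    by rewrite -[H]setTI; apply: measurable_tcons => //; exact: measurable_separated.
  (* Unfolded, this integral is the measure of the separated [m.+1]-tuples. *)
  have H0 : (\int[P]_x (power_probability P m \o xsection H) x = 0)%E.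
    apply/eqP; rewrite -[_ == _]negbK; apply/negP => H0.
    have : pos m.+1 by rewrite /pos lt0e H0 measure_ge0.
    by move/maxm; rewrite ltnn.
  have := @ge0_integral_eq0_ae _ _ _ P setT _ measurableT
    (measurable_fun_xsection (power_probability P m) mH) (fun x _ => measure_ge0 _ _) H0.
  move=> aeH; have {}H0 : {ae power_probability P m, forall t, P (ysection H t) = 0%E}.
    by apply: ae_ysection0 => //; apply: filterS aeH => x; apply.
  have [t tsep Ht] := ae_exists (@measurable_separated m delta) posm H0.
  by exists t => //; rewrite -[RHS]Ht ysectionE.
exists m, t; split; first exact: separated_size.
have mS : measurable [set x | separated delta (tcons (x, t))].
  have := @measurable_tcons _ J m; move=> mt.
  have := measurableT_comp mt (pair2_measurable t).
  move=> /(_ measurableT _ (@measurable_separated m.+1 delta)).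
  by rewrite setTI.
have := ae_notin mS tnull; apply: filterS => x nx; apply: contrapT => ni; apply: nx.
have dx i : (delta%:E <= row_dist x (tnth t i))%E.
  by rewrite leNgt; apply/negP => lt_d; apply: ni; exists i.
move=> i k; case: (unliftP ord0 i) => [i'|] ->; case: (unliftP ord0 k) => [k'|] -> ik.
- by rewrite !tnthS; apply: tsep; apply: contraNN ik => /eqP ->.
- by rewrite tnthS row_distC; exact: dx.
- by rewrite tnthS; exact: dx.
- by rewrite eqxx in ik.
Qed.

(** * From a net of rows to a partition *)

Variables (m : nat) (t : m.-tuple J) (delta : R).

Lemma exists_net_classes :
  {ae P, forall x, exists i, (row_dist x (tnth t i) < delta%:E)%E} ->
  exists c : J -> 'I_m,
    [/\ forall i, measurable (c @^-1` [set i]),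
        forall x, (0 < P (c @^-1` [set c x]))%E
      & {ae P, forall x, (row_dist x (tnth t (c x)) < delta%:E)%E}].
Proof.
move=> net.
have PT : (0 < P setT)%E by rewrite probability_setT.
have [_ _ [i0 _]] := ae_exists measurableT PT net.
pose b i x := (row_dist x (tnth t i) < delta%:E)%E.
have mb i : measurable [set x | b i x].
  have := measurable_row_dist (@measurable_id _ J setT)
    (@measurable_cst _ _ J J setT (tnth t i)).
  move=> /(_ measurableT _ (@emeasurable_itv R `]-oo, delta%:E[)).
  rewrite setTI; congr measurable; apply/seteqP; split=> x /=; rewrite in_itv //=.
(* The default [i0] serves the points lying in no ball, which form a null set. *)
pose g (beta : {ffun 'I_m -> bool}) := odflt i0 [pick i | beta i].
pose c0 x := g [ffun i => b i x].
have mc0 i : measurable (c0 @^-1` [set i]).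
  exact: (measurable_finite_bits (fun beta => g beta = i) mb).
have bc0 : {ae P, forall x, b (c0 x) x}.
  apply: filterS net => x [i xi]; rewrite /c0 /g.
  by case: pickP => [k|/(_ i)]; rewrite ffunE //= /b xi.
have nnull : {ae P, forall x, P (c0 @^-1` [set c0 x]) != 0%E}.
  have : {ae P, forall x i, P (c0 @^-1` [set i]) = 0%E -> c0 x != i}.
    apply: ae_forall_fin => i; have [Pi|nPi] := pselect (P (c0 @^-1` [set i]) = 0%E).
      by have := ae_notin (mc0 i) Pi; apply: filterS => x nx _; apply/eqP.
    exact: aeW.
  by apply: filterS => x /(_ (c0 x)) nx; apply/eqP => /nx; rewrite eqxx.
(* Null classes are merged into the class of [x1]. *)
have [x1 _ Px1] := ae_exists measurableT PT nnull.
pose h i := if P (c0 @^-1` [set i]) == 0%E then c0 x1 else i.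
have Ph i : P (c0 @^-1` [set h i]) != 0%E by rewrite /h; case: ifPn.
exists (fun x => h (c0 x)); split.
- by move=> i; exact: (measurable_finite_bits (fun beta => h (g beta) = i) mb).
(* Since [h] fixes the index [h (c0 x)], the class contains a non-null fiber of [c0]. *)
- move=> x; apply: (@lt_le_trans _ _ (P (c0 @^-1` [set h (c0 x)]))).
    by rewrite lt0e Ph measure_ge0.
  rewrite le_measure ?inE //.
    exact: (measurable_finite_bits (fun beta => h (g beta) = h (c0 x)) mb).
  by move=> y /= ->; rewrite /h (negbTE (Ph (c0 x))).
- by apply: filterS2 bc0 nnull => x bx nx; rewrite /h (negbTE nx).
Qed.

Variable c : J -> 'I_m.
Hypothesis mc : forall i, measurable (c @^-1` [set i]).
Hypothesis c_pos : forall x, (0 < P (c @^-1` [set c x]))%E.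
Hypothesis c_net : {ae P, forall x, (row_dist x (tnth t (c x)) < delta%:E)%E}.

(** Ranging over points instead of indices leaves out the empty fibers. *)
Definition classes : set (set J) := range (fun x => c @^-1` [set c x]).

Lemma classes_partition : measurable_partition P classes.
Proof.
split; last by move=> _ [x _ <-]; split; [exact: mc|exact: c_pos].
split.
- apply/seteqP; split=> // x _; exists (c @^-1` [set c x]) => //.
  by exists x.
- by move=> _ _ [x _ <-] [y _ <-] [z [/= -> ->]].
- by move=> _ [x _ <-]; exists x => /=.
Qed.

Lemma pblock_classes x : pblock classes id x = c @^-1` [set c x].
Proof.
have : exists A, classes A /\ id A x by exists (c @^-1` [set c x]); split=> //; exists x.
move=> /getPex; rewrite /pblock /pblock_index; set A := get _.
by move=> [[y _ <-] /= ->].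
Qed.

Lemma card_classes : exists2 k : nat, (classes #= `I_k)%card & (k <= m)%N.
Proof.
have classes_sub : classes `<=` (fun i => c @^-1` [set i]) @` [set: 'I_m].
  by move=> _ [x _ <-]; exists (c x).
have leI : (classes #<= [set: 'I_m])%card.
  exact: card_le_trans (subset_card_le classes_sub) (card_image_le _ _).
have [k ck] : exists k, (classes #= `I_k)%card.
  by apply/finite_setP; exact: card_le_finite leI _.
by exists k => //; rewrite -card_le_II -(card_le_eql ck) (card_le_eqr card_II).
Qed.

(** * Error of the block averages *)

(** On each rectangle of classes the step function is constant and [stepping] is the mean of [W], so
    [integral_dist_mean] applies to each rectangle. *)
Lemma stepping_dist_le (v : 'I_m -> 'I_m -> R) :
  (\int[(P \x P)%E]_z `|W z.1 z.2 - stepping P W classes z.1 z.2|%:E <=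
   2%:E * \int[(P \x P)%E]_z `|W z.1 z.2 - v (c z.1) (c z.2)|%:E)%E.
Proof.
pose c2 (z : J * J) := (c z.1, c z.2).
have c2E p : c2 @^-1` [set p] = c @^-1` [set p.1] `*` c @^-1` [set p.2].
  case: p => i k; apply/seteqP; split=> [[x y] [<- <-]|[x y] [/= <- <-]] //.
have mc2 p : measurable (c2 @^-1` [set p]) by rewrite c2E; exact: measurableX.
have mh (h : 'I_m -> 'I_m -> R) :
    measurable_fun setT (fun z : J * J => `|W z.1 z.2 - h (c z.1) (c z.2)|%:E).
  apply/measurable_EFinP; apply: measurableT_comp => //; apply: measurable_funB => //.
  exact: (measurable_fun_finite_classes mc2 (fun p => h p.1 p.2)).
pose a i k := block_average P W (c @^-1` [set i]) (c @^-1` [set k]).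
rewrite (eq_integral (fun z => `|W z.1 z.2 - a (c z.1) (c z.2)|%:E)); last first.
  by move=> z _; rewrite /stepping !pblock_classes.
rewrite (ge0_integral_classes mc2) //.
rewrite [X in (_ <= _ * X)%E](ge0_integral_classes mc2) //.
rewrite ge0_sume_distrr; last by move=> p _; exact: integral_ge0.
apply: lee_sum => -[i k] _.
rewrite (eq_integral (fun z => `|W z.1 z.2 - a i k|%:E)); last first.
  by move=> z /set_mem [<- <-].
rewrite [X in (_ <= _ * X)%E](eq_integral (fun z => `|W z.1 z.2 - v i k|%:E)); last first.
  by move=> z /set_mem [<- <-].
have := integral_dist_mean (P \x P)%E (v i k) (mc2 (i, k)) Wm (fun z => W01 z.1 z.2).
rewrite /a /block_average c2E /= => le_v; apply: le_trans le_v.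
by rewrite product_measure1E // fineM // fin_num_measure.
Qed.

Lemma row_dist_triangle x y z : (row_dist x z <= row_dist x y + row_dist y z)%E.
Proof.
have mW x1 x2 : measurable_fun setT (fun u => `|W x1 u - W x2 u|%:E).
  by apply: measurable_abs_diff => //; exact: measurable_cst.
rewrite /row_dist -ge0_integralD //; apply: ge0_le_integral => //.
- by apply: emeasurable_funD.
- by move=> u _; rewrite -EFinD lee_fin ler_distD.
Qed.

(** Moving the row [x] to a representative of its class costs [2 * delta], through the center of the
    class; moving the column to its center costs [delta] on average. *)
Lemma exists_step_function : exists v : 'I_m -> 'I_m -> R,
  (\int[(P \x P)%E]_z `|W z.1 z.2 - v (c z.1) (c z.2)|%:E <= (3 * delta)%:E)%E.
Proof.
pose s y := tnth t (c y).
have ms : measurable_fun setT s by exact: (measurable_fun_finite_classes mc (tnth t)).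
pose h (z : J * J) : \bar R := `|W z.1 z.2 - W z.1 (s z.2)|%:E.
have mh : measurable_fun setT h.
  apply: measurable_abs_diff => //; exact: (measurableT_comp ms measurable_snd).
have h0 z : (0 <= h z)%E by rewrite lee_fin.
pose g : J -> \bar R := fubini_F P h.
have mg : measurable_fun setT g by exact: measurable_fun_fubini_tonelli_F.
have g0 x : (0 <= g x)%E by exact: integral_ge0.
have dist0 x y : (0 <= row_dist x y)%E by apply: integral_ge0 => u _; rewrite lee_fin.
have PT (k : R) : (\int[P]_x k%:E = k%:E)%E.
  by rewrite integral_cst //= probability_setT mule1.
have delta0 : 0 <= delta.
  have [x _ xd] := ae_exists (P := P) measurableT (ltac:(by rewrite probability_setT)) c_net.
  by rewrite -lee_fin (le_trans _ (ltW xd)).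
(* By symmetry of [W], integrating [h] over its first variable gives [row_dist y (s y)], which is
   below [delta] for almost every [y]. *)
have Ig : (\int[P]_x g x <= delta%:E)%E.
  have -> : (\int[P]_x g x = \int[P]_y fubini_G P h y)%E by exact: fubini_tonelli.
  rewrite -(PT delta).
  apply: ae_ge0_le_integral => //.
  - by move=> y _; apply: integral_ge0.
  - exact: measurable_fun_fubini_tonelli_G.
  apply: filterS c_net => y /ltW cy _; apply: le_trans cy.
  by rewrite le_eqVlt; apply/orP; left; apply/eqP; apply: eq_integral => x _;
    rewrite /h /= Wsym (Wsym x).
(* Rows of [W] are controlled only in [L1], so evaluating [W] at a fixed point of
   each class would not do: [a i] is a point of class [i] at which the error [g]
   of replacing columns by centers is at most its average over the class. *)
have ex_a i : exists a, (g a * P (c @^-1` [set i]) <= \int[P]_(x in c @^-1` [set i]) g x)%E /\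
    ((0 < P (c @^-1` [set i]))%E -> (row_dist a (tnth t i) < delta%:E)%E).
  have [Pi|Pi] := boolP (0 < P (c @^-1` [set i]))%E; last first.
    exists (tnth t i); split; last by move=> Pi'; case/negP: Pi.
    move: Pi; rewrite lt0e measure_ge0 andbT negbK => /eqP ->.
    by rewrite mule0; exact: integral_ge0.
  have mgi : measurable_fun (c @^-1` [set i]) g by exact: measurable_funS mg.
  have [a [ai ad ga]] := exists_le_average (mc i) Pi c_net mgi (fun x _ => g0 x).
  by exists a; split=> // _; rewrite -ai.
have [a aP] := choice ex_a.
exists (fun i k => W (a i) (tnth t k)).
have mac : measurable_fun setT (fun x => a (c x)).
  exact: (measurable_fun_finite_classes mc a).
have mv : measurable_fun setT (fun z : J * J => `|W z.1 z.2 - W (a (c z.1)) (tnth t (c z.2))|%:E).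
  apply: measurable_abs_diff => //.
  - exact: (measurableT_comp mac measurable_fst).
  - exact: (measurableT_comp ms measurable_snd).
have mga : measurable_fun setT (fun x => g (a (c x))) by exact: measurableT_comp mg mac.
have Iga : (\int[P]_x g (a (c x)) <= delta%:E)%E.
  apply: le_trans Ig.
  rewrite (ge0_integral_classes mc) // [leRHS](ge0_integral_classes mc) //.
  apply: lee_sum => i _; apply: le_trans (aP i).1.
  rewrite (eq_integral (cst (g (a i)))); first by rewrite integral_cst.
  by move=> x /set_mem /= ->.
rewrite fubini_tonelli1 //.
apply: (@le_trans _ _ (\int[P]_x (2 * delta)%:E + \int[P]_x g (a (c x)))%E); last first.
  by rewrite PT (_ : 3 * delta = 2 * delta + delta) ?EFinD ?leeD //; ring.
have d2 : (0 <= (2 * delta)%:E)%E by rewrite lee_fin mulr_ge0.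
rewrite -ge0_integralD //.
apply: ae_ge0_le_integral => //.
- by move=> x _; apply: integral_ge0.
- exact: measurable_fun_fubini_tonelli_F.
- by move=> x _; rewrite adde_ge0.
- exact: emeasurable_funD.
apply: filterS c_net => x xd _.
(* The triangle inequality goes through [W (a (c x)) y]. *)
apply: (@le_trans _ _ (row_dist x (a (c x)) + g (a (c x)))%E).
  rewrite /g /fubini_F /row_dist -ge0_integralD //.
  - apply: ge0_le_integral => //.
    + exact: (measurableT_comp mv (pair1_measurable x)).
    + apply: emeasurable_funD.
        by apply: measurable_abs_diff => //; exact: measurable_cst.
      exact: (measurableT_comp mh (pair1_measurable _)).
    + by move=> y _; rewrite /h -EFinD lee_fin ler_distD.
  - by apply: measurable_abs_diff => //; exact: measurable_cst.
  - exact: (measurableT_comp mh (pair1_measurable _)).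
rewrite leeD2r //; apply: (le_trans (row_dist_triangle _ (tnth t (c x)) _)).
rewrite (_ : 2 * delta = delta + delta); last by ring.
rewrite EFinD leeD ?(ltW xd) //; rewrite row_distC.
by apply/ltW/(aP (c x)).2.
Qed.

End graphon_regularity.

(** * Choice of the radius and the final count *)

Local Open Scope card_scope.
Local Open Scope ring_scope.

Theorem theorem5p9 (R : realType) (d : measure_display) (J : measurableType d)
    (P : probability J R) (W : J -> J -> R) (F : bigraph) :
  is_graphon P W -> thin P W -> tind F P W = 0%E ->
  exists C : R, forall eps : R, 0 < eps -> eps < 1 ->
    exists (Q : set (set J)) (k : nat),
      [/\ ultra_strong_partition P W eps Q,
          Q #= `I_k
        & k%:R <= C * eps ^- (10 * bg_order F ^ 2)].
Proof.
move=> [_ Wm Wsym W01] _ F0; set n := bg_order F.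
have n0 : (0 < n)%N by exact: bg_order_gt0 Wm W01 F0.
(* This is the net bound at radius [eps / 6] with the power of [eps] taken out. *)
exists (((4 * n + 2)%:R * 6) ^+ (2 * n)) => eps eps0 eps1.
(* The divisor 6 combines the error [3 * delta] of the step function with the factor 2 for block
   averages. *)
have d01 : 0 < eps / 6 <= 1 by lra.
have [m [t [mB net]]] := exists_net Wm Wsym W01 F0 d01.
have [c [mc c_pos c_net]] := exists_net_classes Wm net.
have [k ck km] := card_classes c.
exists (classes c), k; split=> //.
- split; first exact: classes_partition.
  have [v vP] := exists_step_function Wm Wsym mc c_pos c_net.
  apply: le_trans (stepping_dist_le P Wm W01 mc v) _.
  apply: (@le_trans _ _ (2%:E * (3 * (eps / 6))%:E)%E).
    by apply: lee_wpmul2l.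
  by rewrite -EFinM lee_fin; lra.
- apply: (@le_trans _ _ m%:R); first by rewrite ler_nat.
  apply: (le_trans mB); rewrite -/n invf_div mulrA exprMn -exprVn.
  rewrite ler_wpM2l ?exprn_ge0 //.
  (* As [eps^-1 >= 1], it suffices that [2 * n <= 10 * n ^ 2], which holds for [n > 0]. *)
  by rewrite ler_weXn2l ?invf_ge1 ?(ltW eps1) // expnS; nia.
Qed.
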